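(* Let $f\colon\mathbb{R}^n\to\mathbb{R}\cup\{+\infty\}$ be convex, $A_1\in\mathbb{R}^{m_1\times n}$, $A_2\in\mathbb{R}^{m_2\times n}$, $b_1\in\mathbb{R}^{m_1}$, $b_2\in\mathbb{R}^{m_2}$. Suppose that: (1) for every $(s_1,s_2)\in\mathcal{S}$, the problem of minimizing $f(x)$ subject to $A_1x-b_1+s_1=0$, $A_2x-b_2+s_2=0$, $x\in\operatorname{dom} f$ has at least one optimal solution; (2) $\operatorname{argmin}_{x\in\operatorname{dom} f}\frac12\|b_1-A_1x\|^2\neq\emptyset$ and $\operatorname{argmin}_{x\in\mathcal{X}_1}\frac12\|b_2-A_2x\|^2\neq\emptyset$, so that the hierarchically optimal shift $(s_1^\ast,s_2^\ast)$ is defined; (3) $f$ is closed proper convex, and there exists $\bar x\in\operatorname{ri}(\operatorname{dom} f)$ with $A_1\bar x-b_1+s_1^\ast=0$ and $A_2\bar x-b_2+s_2^\ast=0$; (4) the set $A(\operatorname{dom} f)=\{Ax\colon x\in\operatorname{dom} f\}$ is closed, where $A=\begin{bmatrix} A_1 \\ A_2 \end{bmatrix}$; (5) the positive sequences $\{\sigma_1^{(k)}\}_{k\ge0}$, $\{\sigma_2^{(k)}\}_{k\ge0}$ satisfy $\lim_{k\to\infty}\sigma_1^{(k)}/\sigma_2^{(k)}=\infty$ and $\sigma_1^{(k-1)}/\sigma_2^{(k-1)}\le\sigma_1^{(k)}/\sigma_2^{(k)}$ for all $k\ge1$. Let $\{x^{(k)}\}$ be an infinite sequence generated by the augmented Lagrangian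 method with infeasibility control (described in the context). Then any accumulation point of $\{x^{(k)}\}$ is an optimal solution of the problem $$\text{minimize } f(x)\quad\text{subject to } A_1x-b_1+s_1^\ast=0,\ A_2x-b_2+s_2^\ast=0,\ x\in\operatorname{dom} f.$$
   Context: $\|\cdot\|$ is the Euclidean norm, $\operatorname{dom} f=\{x\colon f(x)<+\infty\}$, $\operatorname{ri}$ is the relative interior. $\mathcal{S}:=\{(s_1,s_2)\in\mathbb{R}^{m_1}\times\mathbb{R}^{m_2}\colon\exists x\in\operatorname{dom} f,\ s_1=b_1-A_1x,\ s_2=b_2-A_2x\}$. Hierarchically optimal shift: $s_1^\ast:=b_1-A_1x^\dagger$ with $x^\dagger\in\operatorname{argmin}_{x\in\operatorname{dom} f}\frac12\|b_1-A_1x\|^2$; $\mathcal{X}_1:=\{x\in\operatorname{dom} f\colon s_1^\ast=b_1-A_1x\}$; $s_2^\ast:=b_2-A_2x^\ddagger$ with $x^\ddagger\in\operatorname{argmin}_{x\in\mathcal{X}_1}\frac12\|b_2-A_2x\|^2$. For $\sigma=(\sigma_1,\sigma_2)$ with $\sigma_1,\sigma_2>0$, $(\bar x(\sigma),\bar s_1(\sigma),\bar s_2(\sigma))$ denotes an optimal solution of: minimize $\frac{\sigma_1}{2}\|s_1\|^2+\frac{\sigma_2}{2}\|s_2\|^2$ over $(x,s_1,s_2)\in\mathbb{R}^n\times\mathbb{R}^{m_1}\times\mathbb{R}^{m_2}$ subject to $s_1=b_1-A_1x$, $s_2=b_2-A_2x$, $x\in\operatorname{dom} f$. (Under (3) and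 (4) it exists and $(\bar s_1(\sigma),\bar s_2(\sigma))$ is unique.) Augmented Lagrangian, for $\rho>0$: $$\mathcal{F}_{\rho,\sigma}(x,\lambda_1,\lambda_2):=f(x)+\sum_{i=1}^2\lambda_i^\top(A_ix-b_i+\bar s_i(\sigma))+\frac{\rho}{2}\sum_{i=1}^2\|A_ix-b_i+\bar s_i(\sigma)\|^2.$$ For $\varepsilon\ge0$, $\bar z$ is an $\varepsilon$-optimal solution of minimizing $\psi$ over $Z$ if $\bar z\in Z$ and $\psi(\bar z)\le\inf_{z\in Z}\psi(z)+\varepsilon$. For a (nonempty) compact set $\mathcal{C}$, $\mathcal{P}_{\mathcal{C}}(z)$ is the projection of $z$ onto $\mathcal{C}$, i.e. a point of $\mathcal{C}$ at minimal Euclidean distance from $z$. The algorithm: fix $\tau\in(0,1)$, $\gamma>1$, compact sets $\Gamma_1\subset\mathbb{R}^{m_1}$, $\Gamma_2\subset\mathbb{R}^{m_2}$, positive sequences $\{\sigma_1^{(k)}\},\{\sigma_2^{(k)}\}$ as in (5), and positive $\{\varepsilon^{(k)}\}$ with $\varepsilon^{(k)}\to0$. Initialize $s_i^{(0)}\in\mathbb{R}^{m_i}$ and $\widehat\lambda_i^{(0)}\in\mathbb{R}^{m_i}$ ($i=1,2$), $u^{(0)}>0$, $\rho^{(0)}>0$. Write $\sigma^{(k)}=(\sigma_1^{(k)},\sigma_2^{(k)})$. For $k=0,1,2,\dots$: Step 1: compute $(\bar s_1(\sigma^{(k)}),\bar s_2(\sigma^{(k)}))$. Step 2: let $x^{(k+1)}$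 be an $\varepsilon^{(k)}$-optimal solution of minimizing $\mathcal{F}_{\rho^{(k)},\sigma^{(k)}}(x,\widehat\lambda_1^{(k)},\widehat\lambda_2^{(k)})$ over $x\in\operatorname{dom} f$. Step 3: for $i=1,2$ set $s_i^{(k+1)}:=A_ix^{(k+1)}-b_i+\bar s_i(\sigma^{(k)})$, $\lambda_i^{(k+1)}:=\widehat\lambda_i^{(k)}+\rho^{(k)}s_i^{(k+1)}$, $\widehat\lambda_i^{(k+1)}:=\mathcal{P}_{\Gamma_i}(\widehat\lambda_i^{(k)}+\rho^{(k)}s_i^{(k+1)})$; set $u^{(k+1)}:=\|s_1^{(k+1)}\|+\|s_2^{(k+1)}\|$; set $\rho^{(k+1)}:=\rho^{(k)}$ if $u^{(k+1)}\le\tau u^{(k)}$ and $\rho^{(k+1)}:=\gamma\rho^{(k)}$ otherwise. *)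

(* Defs.v *)
From HB Require Import structures.
From mathcomp Require Import all_boot all_order all_algebra.
From mathcomp Require Import all_classical all_reals all_analysis.

Set Implicit Arguments.
Unset Strict Implicit.
Unset Printing Implicit Defensive.

Import Order.TTheory GRing.Theory Num.Theory.
Import numFieldNormedType.Exports.

Local Open Scope classical_set_scope.
Local Open Scope ring_scope.

(** Euclidean norm. The norm [`| _ |] that the library puts on matrices is the
    sup norm; it induces the same topology, and topological notions ([closed],
    [compact], [cluster]) below are the library's. *)
Definition enorm (R : realType) (n : nat) (v : 'cV[R]_n) : R :=
  Num.sqrt (\sum_(i < n) v i 0 ^+ 2).

Definition argmin d (T : Type) (U : porderType d) (psi : T -> U) (Z : set T) :
    set T :=
  [set z | Z z /\ forall w, Z w -> (psi z <= psi w)%O].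

(** If the infimum is [-oo], no real-valued point is [eps]-optimal. *)
Definition eps_argmin (R : realType) (T : Type) (psi : T -> \bar R) (Z : set T)
    (eps : R) : set T :=
  [set z | Z z /\ (psi z <= ereal_inf (psi @` Z) + eps%:E)%E].

(** Points of [C] nearest to [z]; a singleton only when [C] is, e.g., closed
    convex and nonempty. *)
Definition proj_set (R : realType) (n : nat) (C : set 'cV[R]_n)
    (z : 'cV[R]_n) : set 'cV[R]_n :=
  argmin (fun p => enorm (z - p)) C.

Definition affine_set (R : realType) (n : nat) (M : set 'cV[R]_n) : Prop :=
  forall (x y : 'cV[R]_n) (t : R), M x -> M y -> M ((1 - t) *: x + t *: y).

Definition affine_hull (R : realType) (n : nat) (C : set 'cV[R]_n) :
    set 'cV[R]_n :=
  \bigcap_(M in [set M | affine_set M /\ C `<=` M]) M.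

Definition rel_int (R : realType) (n : nat) (C : set 'cV[R]_n) :
    set 'cV[R]_n :=
  [set x | affine_hull C x /\ exists2 e : R, 0 < e &
    forall y, affine_hull C y -> enorm (y - x) <= e -> C y].

Definition effdom (R : realType) (n : nat) (f : 'cV[R]_n -> \bar R) :
    set 'cV[R]_n :=
  [set x | (f x < +oo)%E].

(** Meant for functions that do not take the value [-oo], so that the
    right-hand side is never of the form [+oo - oo]. *)
Definition econvex (R : realType) (n : nat) (f : 'cV[R]_n -> \bar R) : Prop :=
  forall (x y : 'cV[R]_n) (t : R), 0 < t -> t < 1 ->
    (f ((1 - t) *: x + t *: y)%R <= (1 - t)%R%:E * f x + t%:E * f y)%E.

Definition proper_fun (R : realType) (n : nat) (f : 'cV[R]_n -> \bar R) :
    Prop :=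
  (forall x, f x != -oo%E) /\ effdom f !=set0.

Definition epigraph (R : realType) (n : nat) (f : 'cV[R]_n -> \bar R) :
    set ('cV[R]_n * R) :=
  [set p | (f p.1 <= p.2%:E)%E].

Definition closed_fun (R : realType) (n : nat) (f : 'cV[R]_n -> \bar R) :
    Prop :=
  closed (epigraph f).

Section Problem.
Variables (R : realType) (n m1 m2 : nat) (f : 'cV[R]_n -> \bar R).
Variables (A1 : 'M[R]_(m1, n)) (A2 : 'M[R]_(m2, n)).
Variables (b1 : 'cV[R]_m1) (b2 : 'cV[R]_m2).

Definition feasible_shifts : set ('cV[R]_m1 * 'cV[R]_m2) :=
  [set s | exists x, [/\ effdom f x, s.1 = b1 - A1 *m x & s.2 = b2 - A2 *m x]].

Definition shifted_feasible (s1 : 'cV[R]_m1) (s2 : 'cV[R]_m2) : set 'cV[R]_n :=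
  [set x | [/\ A1 *m x - b1 + s1 = 0, A2 *m x - b2 + s2 = 0 & effdom f x]].

Definition shifted_solutions (s1 : 'cV[R]_m1) (s2 : 'cV[R]_m2) :
    set 'cV[R]_n :=
  argmin f (shifted_feasible s1 s2).

Definition level1_argmin : set 'cV[R]_n :=
  argmin (fun x => 2^-1 * enorm (b1 - A1 *m x) ^+ 2) (effdom f).

Definition level1_set (s1 : 'cV[R]_m1) : set 'cV[R]_n :=
  [set x | effdom f x /\ s1 = b1 - A1 *m x].

Definition level2_argmin (s1 : 'cV[R]_m1) : set 'cV[R]_n :=
  argmin (fun x => 2^-1 * enorm (b2 - A2 *m x) ^+ 2) (level1_set s1).

Definition hierarchical_shift (s1 : 'cV[R]_m1) (s2 : 'cV[R]_m2) : Prop :=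
  (exists2 x, level1_argmin x & s1 = b1 - A1 *m x) /\
  (exists2 x, level2_argmin s1 x & s2 = b2 - A2 *m x).

Definition weighted_shift_solutions (sg1 sg2 : R) :
    set ('cV[R]_n * 'cV[R]_m1 * 'cV[R]_m2) :=
  argmin
    (fun z => sg1 / 2 * enorm z.1.2 ^+ 2 + sg2 / 2 * enorm z.2 ^+ 2)
    [set z | [/\ z.1.2 = b1 - A1 *m z.1.1, z.2 = b2 - A2 *m z.1.1
               & effdom f z.1.1]].

Definition aug_lagrangian (rho : R) (sb1 : 'cV[R]_m1) (sb2 : 'cV[R]_m2)
    (x : 'cV[R]_n) (lam1 : 'cV[R]_m1) (lam2 : 'cV[R]_m2) : \bar R :=
  (f x +
   ((lam1^T *m (A1 *m x - b1 + sb1)) 0 0 +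
    (lam2^T *m (A2 *m x - b2 + sb2)) 0 0 +
    rho / 2 * (enorm (A1 *m x - b1 + sb1) ^+ 2 +
               enorm (A2 *m x - b2 + sb2) ^+ 2))%R%:E)%E.

End Problem.

(** [al_lamh1], [al_lamh2] are the safeguarded multipliers. In the initial
    state the components [al_x], [al_lam1], [al_lam2] are never used. *)
Record al_state (R : realType) (n m1 m2 : nat) := AlState {
  al_x : 'cV[R]_n;
  al_s1 : 'cV[R]_m1;
  al_s2 : 'cV[R]_m2;
  al_lam1 : 'cV[R]_m1;
  al_lam2 : 'cV[R]_m2;
  al_lamh1 : 'cV[R]_m1;
  al_lamh2 : 'cV[R]_m2;
  al_u : R;
  al_rho : R
}.

Definition al_init (R : realType) (n m1 m2 : nat) (st : al_state R n m1 m2) :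
    Prop :=
  0 < al_u st /\ 0 < al_rho st.

(** One iteration, from [st] to [st']; a relation because the solutions of the
    subproblems and the projections on nonconvex sets need not be unique. *)
Definition al_step (R : realType) (n m1 m2 : nat) (f : 'cV[R]_n -> \bar R)
    (A1 : 'M[R]_(m1, n)) (A2 : 'M[R]_(m2, n))
    (b1 : 'cV[R]_m1) (b2 : 'cV[R]_m2)
    (tau gamma : R) (G1 : set 'cV[R]_m1) (G2 : set 'cV[R]_m2)
    (sg1 sg2 eps : R) (st st' : al_state R n m1 m2) : Prop :=
  exists xb sb1 sb2,
    weighted_shift_solutions f A1 A2 b1 b2 sg1 sg2 (xb, sb1, sb2) /\
    eps_argmin
      (fun x => aug_lagrangian f A1 A2 b1 b2 (al_rho st) sb1 sb2 x
                  (al_lamh1 st) (al_lamh2 st))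
      (effdom f) eps (al_x st') /\
    [/\ al_s1 st' = A1 *m al_x st' - b1 + sb1,
        al_lam1 st' = al_lamh1 st + al_rho st *: al_s1 st'
      & proj_set G1 (al_lamh1 st + al_rho st *: al_s1 st') (al_lamh1 st')] /\
    [/\ al_s2 st' = A2 *m al_x st' - b2 + sb2,
        al_lam2 st' = al_lamh2 st + al_rho st *: al_s2 st'
      & proj_set G2 (al_lamh2 st + al_rho st *: al_s2 st') (al_lamh2 st')] /\
    al_u st' = enorm (al_s1 st') + enorm (al_s2 st') /\
    al_rho st' = (if al_u st' <= tau * al_u st then al_rho st
                  else gamma * al_rho st).

(* Main.v *)
Require Import Defs.
From HB Require Import structures.
From mathcomp Require Import all_boot all_order all_algebra.
From mathcomp Require Import all_classical all_reals all_analysis.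
From mathcomp Require Import ring lra.
Import Order.TTheory GRing.Theory Num.Theory.
Import numFieldNormedType.Exports.
Local Open Scope classical_set_scope.
Local Open Scope ring_scope.

(** Let [D = dom f], let [xh] be the Slater point, and let the columns of [B]
    span the directions of [D] at [xh], so that [xh + B c] lies in [D] for small
    [c].

    Optimality of the hierarchical shift in both directions [c] and [- c] gives
    [<s1s, A1 B c> = 0] and [<s2s, A2 B c> = <w, A1 B c>] for a fixed [w]. Hence
    the errors [v1], [v2] of the weighted shift satisfy
    [r |v1|^2 + |v2|^2 + 2 <w, v1> <= 0] with [r = sg1 / sg2], and both tend to [0]
    as [r] grows.

    A convex function is bounded above near [xh] relative to [D], so a point [w]
    feasible for the limit problem can be perturbed into a point feasible for the
    problem of step [k] at a vanishing cost. Comparison with that point bounds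
    [f x + <lam, s> + rho / 2 |s|^2] by [f w + o(1)] at the new iterate. Either the
    infeasibility tends to [0] geometrically, or the penalty parameter tends to
    infinity; since the safeguarded multipliers are bounded, in both cases the
    added terms have a nonnegative lower limit, and they force [s] to tend to [0]
    along iterates on which [f] is bounded below. Closedness of [f] concludes. *)

(** * Linear algebra: spanning columns *)

(** Take columns from [E] of maximal rank: appending [v] cannot raise the rank, so [v] lies in their
    span. *)
Lemma span_columns {F : fieldType} n (E : set 'cV[F]_n) :
  exists k (B : 'M[F]_(n, k)), (forall i, E (col i B)) /\
    (forall v, E v -> exists c, v = B *m c).
Proof.
pose P r := `[< exists k (B : 'M[F]_(n, k)),
  (forall i, E (col i B)) /\ \rank B = r >].
have exP : exists r, P r.
  by exists (\rank (0 : 'M[F]_(n, 0))); apply/asboolP; exists 0, 0; split=> // -[].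
have leP r : P r -> (r <= n)%N.
  by move=> /asboolP[k [B [_ <-]]]; exact: rank_leq_row.
have [r] := ex_maxnP exP leP => /asboolP[k [B [EB rB]]] rmax.
exists k, B; split=> // v Ev.
pose C := row_mx v B.
have rC : (\rank C <= r)%N.
  apply: rmax; apply/asboolP; exists (1 + k)%N, C; split=> // i.
  rewrite -(splitK i); case: (fintype.split i) => j /=; rewrite ?colKl ?colKr //.
  by rewrite (_ : col j v = v) //; apply/matrixP => a b; rewrite mxE !ord1.
have sBC : (B^T <= C^T)%MS by rewrite tr_row_mx -addsmxE addsmxSr.
have /submxP[D defD] : (v^T <= B^T)%MS.
  apply: (@submx_trans _ _ _ _ _ _ C^T); first by rewrite tr_row_mx -addsmxE addsmxSl.
  by rewrite -(geq_leqif (mxrank_leqif_sup sBC)) !mxrank_tr rB.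
by exists D^T; rewrite -[LHS]trmxK defD trmx_mul trmxK.
Qed.

(** * Euclidean inner product *)

Section Euclid.
Context {R : realType} {n : nat}.
Implicit Types u v w : 'cV[R]_n.

Definition dot u v : R := (u^T *m v) 0 0.

Lemma dotE u v : dot u v = \sum_i u i 0 * v i 0.
Proof. by rewrite /dot mxE; apply: eq_bigr => i _; rewrite mxE. Qed.

Lemma dotC u v : dot u v = dot v u.
Proof. by rewrite !dotE; apply: eq_bigr => i _; rewrite mulrC. Qed.

Lemma dotDr u v w : dot u (v + w) = dot u v + dot u w.
Proof. by rewrite /dot mulmxDr mxE. Qed.

Lemma dotZr u a v : dot u (a *: v) = a * dot u v.
Proof. by rewrite /dot -scalemxAr mxE. Qed.

Lemma dotDl u v w : dot (u + v) w = dot u w + dot v w.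
Proof. by rewrite dotC dotDr !(dotC w). Qed.

Lemma dotZl u a v : dot (a *: u) v = a * dot u v.
Proof. by rewrite dotC dotZr dotC. Qed.

Lemma dot_ge0 u : 0 <= dot u u.
Proof. by rewrite dotE sumr_ge0 // => i _; rewrite -expr2 sqr_ge0. Qed.

Lemma enorm_sqr u : enorm u ^+ 2 = dot u u.
Proof.
have -> : dot u u = \sum_i u i 0 ^+ 2.
  by rewrite dotE; apply: eq_bigr => i _; rewrite expr2.
by rewrite sqr_sqrtr // sumr_ge0 // => i _; rewrite sqr_ge0.
Qed.

Lemma enorm_ge0 u : 0 <= enorm u. Proof. exact: sqrtr_ge0. Qed.

Lemma sqr_coord_le_dot u i : u i 0 ^+ 2 <= dot u u.
Proof.
rewrite dotE (bigD1 i) //= -expr2 lerDl sumr_ge0 // => j _.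
by rewrite -expr2 sqr_ge0.
Qed.

Lemma dot_sqrB u v :
  dot u u = dot v v + 2 * dot v (u - v) + dot (u - v) (u - v).
Proof.
have -> : dot u u = dot (v + (u - v)) (v + (u - v)) by rewrite addrC subrK.
move: (u - v) => w.
by rewrite dotDl !dotDr (dotC w v); ring.
Qed.

(** Expand [|th u + v / 2|^2 >= 0] and divide by [th], which stays free for later tuning. *)
Lemma dot_young u v (th : R) : 0 < th ->
  - (th * dot u u + th^-1 * dot v v / 4) <= dot u v.
Proof.
move=> th0; have := dot_ge0 (th *: u + 2^-1 *: v).
rewrite dotDl !dotDr !dotZl !dotZr (dotC v u) => H.
have {}H : 0 <= th^-1 * (th * (th * dot u u) + th * (2^-1 * dot u v) +
   (2^-1 * (th * dot u v) + 2^-1 * (2^-1 * dot v v))).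
  by rewrite mulr_ge0 // invr_ge0 ltW.
rewrite -subr_ge0; apply: le_trans H _; rewrite le_eqVlt; apply/orP; left.
by apply/eqP; field; rewrite gt_eqF.
Qed.

Lemma dot_eq0_of_min {u v} {e : R} : 0 < e ->
  (forall t, `|t| <= e -> dot u u <= dot (u - t *: v) (u - t *: v)) ->
  dot u v = 0.
Proof.
move=> e0 H; apply/eqP/negPn/negP => uv0.
have vv0 := dot_ge0 v.
set a := dot u v in uv0 *; set b := dot v v in vv0 *.
have expand t : dot (u - t *: v) (u - t *: v) = dot u u - 2 * t * a + t ^+ 2 * b.
  by rewrite -scaleNr dotDl !dotDr !dotZl !dotZr (dotC v u) -/a -/b; ring.
have a1 : 0 < 1 + `|a| by rewrite ltr_wpDr.
have b1 : 0 < 1 + b by rewrite ltr_wpDr.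
(* The step [t = th * a] lowers the square by at least [th * a ^+ 2] once [th * b <= 1]. The two
   bounds give this and [|t| <= e]; the added ones avoid division by zero. *)
pose th := Num.min (e / (1 + `|a|)) (1 + b)^-1.
have th0 : 0 < th by rewrite lt_min divr_gt0 // invr_gt0.
have tha : `|th * a| <= e.
  rewrite normrM gtr0_norm // (@le_trans _ _ (e / (1 + `|a|) * (1 + `|a|))) //.
    by rewrite ler_pM ?(ltW th0) ?normr_ge0 // ?ge_min ?lexx // lerDr.
  by rewrite divfK // gt_eqF.
have thb : th * b <= 1.
  rewrite (@le_trans _ _ ((1 + b)^-1 * (1 + b))) //.
    by rewrite ler_pM ?(ltW th0) // ?ge_min ?lexx ?orbT // lerDr.
  by rewrite mulVf // gt_eqF.
have := H _ tha; rewrite expand.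
have -> : dot u u - 2 * (th * a) * a + (th * a) ^+ 2 * b =
    dot u u - th * a ^+ 2 - (th * a ^+ 2) * (1 - th * b) by ring.
have a2 : 0 < a ^+ 2 by rewrite exprn_even_gt0.
have t2 : 0 < th * a ^+ 2 by rewrite mulr_gt0.
have : 0 <= (th * a ^+ 2) * (1 - th * b) by rewrite mulr_ge0 ?(ltW t2) // subr_ge0.
by move=> ? ?; lra.
Qed.

End Euclid.

(** * Affine hulls and relative interior *)

Section AffineHull.
Context {R : realType} {n : nat}.
Implicit Types (D M : set 'cV[R]_n) (x v w : 'cV[R]_n).

Lemma affine_set_dirZ {M x v} (t : R) :
  affine_set M -> M x -> M (x + v) -> M (x + t *: v).
Proof.
move=> aM Mx Mv; have := aM _ _ t Mx Mv.
by rewrite scalerDr addrA -scalerDl subrK scale1r.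
Qed.

(** [v + w] is twice the direction from [x] to the midpoint of [x + v] and [x + w], which lies in
    [M]. *)
Lemma affine_set_dirD {M x v w} :
  affine_set M -> M x -> M (x + v) -> M (x + w) -> M (x + (v + w)).
Proof.
move=> aM Mx Mv Mw.
have -> : v + w = 2 *: (2^-1 *: (v + w)).
  by rewrite scalerA mulfV ?scale1r // pnatr_eq0.
apply: affine_set_dirZ => //.
have := aM _ _ 2^-1 Mv Mw.
rewrite !scalerDr addrACA -!scalerDl subrK scale1r.
by rewrite (_ : 1 - 2^-1 = 2^-1 :> R) //; field.
Qed.

Lemma mulmx_sum_col k (B : 'M[R]_(n, k)) (c : 'cV[R]_k) :
  B *m c = \sum_i c i 0 *: col i B.
Proof.
apply/colP => a; rewrite mxE summxE; apply: eq_bigr => i _.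
by rewrite !mxE mulrC.
Qed.

Lemma affine_hull_comb {D x k} {B : 'M[R]_(n, k)} (c : 'cV[R]_k) :
  affine_hull D x -> (forall i, D (x + col i B)) -> affine_hull D (x + B *m c).
Proof.
move=> Dx DB M [aM DM].
have Mx : M x by apply: Dx.
rewrite mulmx_sum_col; elim/big_ind: _ => [|v w Mv Mw|i _].
- by rewrite addr0.
- exact: affine_set_dirD.
- by apply: affine_set_dirZ => //; exact: DM.
Qed.

Lemma enormZ (t : R) v : enorm (t *: v) = `|t| * enorm v.
Proof.
rewrite /enorm -sqrtr_sqr -sqrtrM ?sqr_ge0 //; congr Num.sqrt.
by rewrite mulr_sumr; apply: eq_bigr => i _; rewrite mxE exprMn.
Qed.

(** Gives linear coordinates on [D]: the columns of [B] are differences [y - x] with [y] in [D], so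
    [x + B c] stays in the affine hull. *)
Lemma rel_int_basis {D x} : rel_int D x ->
  exists k (B : 'M[R]_(n, k)),
    (forall c, exists2 e : R, 0 < e &
       forall t, `|t| <= e -> D (x + t *: (B *m c))) /\
    (forall y, D y -> exists c, y = x + B *m c).
Proof.
move=> [hx [e e0 De]].
have [k [B [EB spanB]]] := span_columns n [set v | D (x + v)].
exists k, B; split=> [c|y Dy]; last first.
  have [|c yc] := spanB (y - x); first by rewrite /= addrC subrK.
  by exists c; rewrite -yc addrC subrK.
have N1 : 0 < 1 + enorm (B *m c) by rewrite ltr_wpDr // enorm_ge0.
exists (e / (1 + enorm (B *m c))) => [|t te]; first by rewrite divr_gt0.
apply: De; first by rewrite scalemxAr; apply: affine_hull_comb.
rewrite addrC addKr enormZ (@le_trans _ _ (e / (1 + enorm (B *m c)) * (1 + enorm (B *m c)))) //.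
  by rewrite ler_pM ?enorm_ge0 ?normr_ge0 // lerDr.
by rewrite divfK // gt_eqF.
Qed.

End AffineHull.

(** * Convex functions near a relative interior point *)

Section ValueFunction.
Context {R : realType} {n : nat} {D : set 'cV[R]_n} {g : 'cV[R]_n -> R}.
Hypothesis cvxD : forall x y t, D x -> D y -> 0 <= t -> t <= 1 ->
  D ((1 - t) *: x + t *: y).
Hypothesis cvxg : forall x y t, D x -> D y -> 0 <= t -> t <= 1 ->
  g ((1 - t) *: x + t *: y) <= (1 - t) * g x + t * g y.
Context {xh : 'cV[R]_n} {k : nat} {B : 'M[R]_(n, k)}.
Hypothesis segB : forall c, exists2 e : R, 0 < e &
  forall t, `|t| <= e -> D (xh + t *: (B *m c)).
Hypothesis spanB : forall y, D y -> exists c, y = xh + B *m c.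

(** Coordinates are added one at a time: the point is the midpoint of one with the other coordinates
    doubled and one moved by [2 c_i] along a single axis, where two end values bound [g]. Each stage
    at least halves the radius. *)
Lemma locally_bounded_above : exists M : R, exists2 e : R, 0 < e &
  forall c : 'cV[R]_k, (forall i, `|c i 0| <= e) ->
    D (xh + B *m c) /\ g (xh + B *m c) <= M.
Proof.
suff [M [e e0 H]] : exists M : R, exists2 e : R, 0 < e &
    forall c : 'cV[R]_k, (forall i, `|c i 0| <= e) ->
      D (xh + \sum_i c i 0 *: col i B) /\ g (xh + \sum_i c i 0 *: col i B) <= M.
  by exists M, e => // c /H; rewrite mulmx_sum_col.
elim: (index_enum _) => [|i s [M [e e0 IH]]].
  exists (g xh), 1 => // c _; rewrite big_nil addr0; split=> //.
  by have [e /ltW e0 /(_ 0)] := segB 0; rewrite normr0 scale0r addr0; apply.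
have [e1 e10 seg1] := segB (delta_mx i 0); rewrite -colE in seg1.
have Dp : D (xh + e1 *: col i B) by apply: seg1; rewrite gtr0_norm.
have Dm : D (xh + (- e1) *: col i B) by apply: seg1; rewrite normrN gtr0_norm.
pose M1 := Num.max (g (xh + e1 *: col i B)) (g (xh + (- e1) *: col i B)).
have bnd t : `|t| <= e1 -> D (xh + t *: col i B) /\ g (xh + t *: col i B) <= M1.
  move=> te; split; first exact: seg1.
  have /andP[t1 t2] : - e1 <= t <= e1 by rewrite -ler_norml.
  pose a := (e1 + t) / (2 * e1).
  have a0 : 0 <= a by rewrite divr_ge0 //; lra.
  have a1 : a <= 1 by rewrite ler_pdivrMr; lra.
  have -> : xh + t *: col i B =
      (1 - a) *: (xh + (- e1) *: col i B) + a *: (xh + e1 *: col i B).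
    rewrite !scalerDr addrACA -scalerDl subrK scale1r !scalerA -scalerDl.
    by congr (_ + _ *: _); rewrite /a; field; rewrite gt_eqF.
  apply: (le_trans (cvxg _ _ _ Dm Dp a0 a1)).
  have -> : M1 = (1 - a) * M1 + a * M1 by ring.
  by rewrite lerD // ler_wpM2l ?subr_ge0 // /M1 le_max lexx ?orbT.
exists (2^-1 * M + 2^-1 * M1), (Num.min e e1 / 2).
  by rewrite divr_gt0 // lt_min e0.
move=> c cs; rewrite big_cons.
have c2 j : `|2 * c j 0| <= Num.min e e1.
  by rewrite normrM ger0_norm // mulrC -ler_pdivlMr.
have [|D1 g1] := IH (2 *: c).
  by move=> j; rewrite mxE (le_trans (c2 j)) // ge_min lexx.
have [|D2 g2] := bnd (2 * c i 0).
  by rewrite (le_trans (c2 i)) // ge_min lexx orbT.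
have -> : xh + (c i 0 *: col i B + \sum_(j <- s) c j 0 *: col j B) =
    (1 - 2^-1) *: (xh + \sum_(j <- s) (2 *: c) j 0 *: col j B)
    + 2^-1 *: (xh + (2 * c i 0) *: col i B).
  rewrite !scalerDr addrACA -scalerDl subrK scale1r; congr (_ + _).
  rewrite scalerA mulKf // addrC; congr (_ + _).
  rewrite scaler_sumr; apply: eq_bigr => j _; rewrite scalerA mxE.
  by congr (_ *: _); field.
have h0 : 0 <= 2^-1 :> R by rewrite invr_ge0.
have h1 : 2^-1 <= 1 :> R by lra.
split; first exact: cvxD.
apply: le_trans (cvxg _ _ _ D1 D2 h0 h1) _.
by lra.
Qed.

(* Upper semicontinuity, relative to its domain and at the image of the
   relative interior point [xh], of [v |-> inf {g z | D z, A z = v}]. *)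
Lemma value_function_usc m (A : 'M[R]_(m, n)) w (e : R) : 0 < e ->
  D w -> A *m w = A *m xh ->
  exists2 dl : R, 0 < dl & forall y, D y ->
    (forall i, `|(A *m y - A *m xh) i 0| <= dl) ->
    exists z, [/\ D z, A *m z = A *m y & g z <= g w + e].
Proof.
move=> e0 Dw Aw.
have [M [e1 e10 bnd]] := locally_bounded_above.
(* Through this generalized inverse, the solution [c'] of [A B c' = A y - A xh] is controlled by the
   right-hand side, unlike the coordinates [c] of [y]. *)
pose P := pinvmx (A *m B).
pose C := 1 + \sum_(p : 'I_k * 'I_m) `|P p.1 p.2|.
have C0 : 0 < C by rewrite ltr_wpDr // sumr_ge0.
(* The weight [t] is chosen so that [t * (M - g w) <= e]. *)
pose t : R := (1 + `|M - g w| / e)^-1.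
have q1 : 1 <= 1 + `|M - g w| / e by rewrite lerDl divr_ge0 // ltW.
have q0 : 0 < 1 + `|M - g w| / e := lt_le_trans ltr01 q1.
have t0 : 0 < t by rewrite invr_gt0.
have t1 : t <= 1 by rewrite invf_le1.
have tM : t * (M - g w) <= e.
  rewrite mulrC ler_pdivrMr // mulrDr mulr1 mulrCA mulfV ?gt_eqF // mulr1.
  by rewrite (le_trans (ler_norm _)) // lerDr ltW.
exists (t * e1 / C); first by rewrite divr_gt0 // mulr_gt0.
move=> y Dy yd; have [c yc] := spanB y Dy.
have uc : A *m y - A *m xh = A *m B *m c.
  by rewrite yc mulmxDr mulmxA addrC addKr.
pose c' := P *m (A *m y - A *m xh).
have Bc' : A *m B *m c' = A *m y - A *m xh.
  by rewrite /c' uc (mulmxA (A *m B)) (mulmxA (A *m B *m P)) mulmxKpV.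
have c's i : `|(t^-1 *: c') i 0| <= e1.
  rewrite mxE normrM gtr0_norm ?invr_gt0 // ler_pdivrMl //.
  rewrite mxE (le_trans (ler_norm_sum _ _ _)) //.
  apply: (@le_trans _ _ (\sum_j `|P i j| * (t * e1 / C))).
    by apply: ler_sum => j _; rewrite normrM ler_wpM2l.
  rewrite -mulr_suml mulrCA ger_pMr ?mulr_gt0 //.
  rewrite ler_pdivrMr // mul1r.
  rewrite /C -(pair_bigA _ (fun a b => `|P a b|)) /= (bigD1 i) //= addrCA lerDl.
  by rewrite addr_ge0 // sumr_ge0 // => ? _; rewrite sumr_ge0.
have [Dv gv] := bnd _ c's.
(* Dividing [c'] by [t] compensates the weight [t], so the image is exactly [A y]. *)
exists ((1 - t) *: w + t *: (xh + B *m (t^-1 *: c'))); split.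
- by apply: cvxD => //; exact: ltW.
- rewrite mulmxDr -!scalemxAr Aw mulmxDr scalerDr addrA -scalerDl subrK scale1r.
  by rewrite -!scalemxAr scalerA mulfV ?gt_eqF // scale1r mulmxA Bc' addrC subrK.
- apply: le_trans (cvxg _ _ _ Dw Dv (ltW t0) t1) _.
  have : t * g (xh + B *m (t^-1 *: c')) <= t * M by rewrite ler_wpM2l // ltW.
  by lra.
Qed.

End ValueFunction.

(** * Convergence of the weighted shifts *)

Lemma sub_shift {V : zmodType} (a b u : V) : b - (a + u) - (b - a) = - u.
Proof. by rewrite opprB (addrC a u) opprD !addrA subrK addrAC subrr sub0r. Qed.

(** The columns of [cokermx M] lie in the kernel of [M], so [u] kills them: this is the criterion
    for membership in the row space. *)
Lemma row_factor {F : fieldType} m n (u : 'rV[F]_n) (M : 'M[F]_(m, n)) :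
  (forall c : 'cV[F]_n, M *m c = 0 -> u *m c = 0) -> exists w, u = w *m M.
Proof.
move=> H; apply/submxP; rewrite submxE; apply/eqP/matrixP => i j.
have Mj : M *m col j (cokermx M) = 0 by rewrite colE mulmxA mulmx_coker mul0mx.
have /matrixP/(_ i 0) := H _ Mj.
by rewrite colE mulmxA -colE !mxE.
Qed.

Section Shifts.
Context {R : realType} {n m1 m2 : nat} {f : 'cV[R]_n -> \bar R}.
Context {A1 : 'M[R]_(m1, n)} {A2 : 'M[R]_(m2, n)} {b1 : 'cV[R]_m1} {b2 : 'cV[R]_m2}.
Context {s1s : 'cV[R]_m1} {s2s : 'cV[R]_m2}.
Hypothesis hier : hierarchical_shift f A1 A2 b1 b2 s1s s2s.
Context {xh : 'cV[R]_n} {k : nat} {B : 'M[R]_(n, k)}.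
Hypothesis Dxh : effdom f xh.
Hypothesis feas1 : s1s = b1 - A1 *m xh.
Hypothesis feas2 : s2s = b2 - A2 *m xh.
Hypothesis segB : forall c, exists2 e : R, 0 < e &
  forall t, `|t| <= e -> effdom f (xh + t *: (B *m c)).
Hypothesis spanB : forall y, effdom f y -> exists c, y = xh + B *m c.

(** Moving [xh] by [t B c], with [t] of either sign, turns the minimal residual [s1s] into
    [s1s - t A1 B c]. *)
Lemma level1_orthogonal c : dot s1s (A1 *m (B *m c)) = 0.
Proof.
have [e e0 De] := segB c.
apply: (dot_eq0_of_min e0) => t te.
case: hier => -[[x [Dx xmin] s1x] _].
have := xmin _ (De _ te); rewrite -s1x !enorm_sqr mulmxDr -scalemxAr opprD addrA.
by rewrite -feas1 ler_pM2l // invr_gt0.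
Qed.

(** Directions killed by [A1] stay in [level1_set s1s], where second-level minimality applies. *)
Lemma level2_orthogonal c : A1 *m (B *m c) = 0 -> dot s2s (A2 *m (B *m c)) = 0.
Proof.
move=> Bc0; have [e e0 De] := segB c.
apply: (dot_eq0_of_min e0) => t te.
case: hier => _ [x [Dx xmin] s2x].
have := xmin (xh + t *: (B *m c)).
rewrite -s2x !enorm_sqr mulmxDr -scalemxAr opprD addrA -feas2 ler_pM2l ?invr_gt0 //.
by apply; split; [exact: De|rewrite mulmxDr -scalemxAr Bc0 scaler0 addr0].
Qed.

(* On the directions of [dom f], the functional [s2s] vanishes on the kernel of
   [A1], hence factors through [A1]. *)
Lemma level2_factor :
  exists w, forall c, dot s2s (A2 *m (B *m c)) = dot w (A1 *m (B *m c)).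
Proof.
have [c|w wE] := @row_factor _ _ _ (s2s^T *m A2 *m B) (A1 *m B).
  rewrite -!mulmxA => /(level2_orthogonal c) sc.
  by apply/matrixP => i j; rewrite !ord1 [RHS]mxE; exact: sc.
exists w^T => c; rewrite /dot trmxK !mulmxA.
by rewrite wE !mulmxA.
Qed.

(* Comparing with [(s1s, s2s)] gives
   [r |v1|^2 + |v2|^2 + 2 <w, v1> <= 0] for the errors [v1], [v2]. *)
Lemma weighted_shift_bound : exists C : R, 0 <= C /\
  forall sg1 sg2 xb sb1 sb2, 0 < sg1 -> 0 < sg2 ->
    weighted_shift_solutions f A1 A2 b1 b2 sg1 sg2 (xb, sb1, sb2) ->
    (sg1 / sg2) / 2 * dot (sb1 - s1s) (sb1 - s1s) + dot (sb2 - s2s) (sb2 - s2s)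
      <= C / (sg1 / sg2).
Proof.
have [w wE] := level2_factor.
exists (2 * dot w w); split; first by rewrite mulr_ge0 // dot_ge0.
move=> sg1 sg2 xb sb1 sb2 g1 g2 [[/= sb1E sb2E Dxb] sbmin].
have [c xbc] := spanB _ Dxb.
have v1E : sb1 - s1s = A1 *m (B *m (- c)).
  by rewrite sb1E feas1 xbc mulmxDr !mulmxN; exact: sub_shift.
have v2E : sb2 - s2s = A2 *m (B *m (- c)).
  by rewrite sb2E feas2 xbc mulmxDr !mulmxN; exact: sub_shift.
have o1 := level1_orthogonal (- c); rewrite -v1E in o1.
have o2 := wE (- c); rewrite -v1E -v2E in o2.
have := sbmin (xh, s1s, s2s) (And3 feas1 feas2 Dxh); rewrite /= !enorm_sqr.
rewrite (dot_sqrB sb1 s1s) (dot_sqrB sb2 s2s) o1 o2; set r := sg1 / sg2.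
have r0 : 0 < r by rewrite divr_gt0.
(* With parameter [r^-1], the cross term [2 <w, v1>] costs half of [r |v1|^2] plus [2 |w|^2 / r]. *)
have := dot_young w (sb1 - s1s) r^-1; rewrite invr_gt0 invrK => /(_ r0).
have -> : sg1 = r * sg2 by rewrite divfK // gt_eqF.
set p := dot w (sb1 - _); set q1 := dot (sb1 - _) _; set q2 := dot (sb2 - _) _.
move=> y H.
have : 0 <= sg2 / 2 * (- (r * q1 + 2 * p + q2)) by lra.
rewrite pmulr_rge0 ?divr_gt0 // => {}H.
have -> : 2 * dot w w / r = 2 * (r^-1 * dot w w) by ring.
by lra.
Qed.

Lemma weighted_shift_cvg (sg1 sg2 : nat -> R) :
  (forall k, 0 < sg1 k) -> (forall k, 0 < sg2 k) ->
  (fun k => sg1 k / sg2 k) @ \oo --> +oo ->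
  forall e : R, 0 < e -> \forall k \near \oo, forall xb sb1 sb2,
    weighted_shift_solutions f A1 A2 b1 b2 (sg1 k) (sg2 k) (xb, sb1, sb2) ->
    dot (sb1 - s1s) (sb1 - s1s) <= e /\ dot (sb2 - s2s) (sb2 - s2s) <= e.
Proof.
move=> g1 g2 /cvgryPge sgy e e0; have [C [C0 HC]] := weighted_shift_bound.
near=> j.
(* [r >= 2] gives [|v1|^2] a coefficient of at least one; [r >= C / e] brings [C / r] below [e]. *)
have r2 : 2 <= sg1 j / sg2 j by near: j; exact: sgy.
have rC : C / e <= sg1 j / sg2 j by near: j; exact: sgy.
move=> xb sb1 sb2 /(HC _ _ _ _ _ (g1 j) (g2 j)).
move: r2 rC; set r := sg1 j / sg2 j => r2.
have r0 : 0 < r by apply: lt_le_trans r2.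
rewrite ler_pdivrMr // mulrC -ler_pdivrMr // => rC.
have := dot_ge0 (sb1 - s1s); have := dot_ge0 (sb2 - s2s).
set q1 := dot (sb1 - _) _; set q2 := dot (sb2 - _) _ => q20 q10 H.
have : 0 <= (r / 2 - 1) * q1 by rewrite mulr_ge0 //; lra.
by move=> ?; split; nra.
Unshelve. all: by end_near. Qed.

End Shifts.

(** * Closed functions, cluster points, elementary estimates *)

Section ClosedFun.
Context {R : realType} {n : nat} {f : 'cV[R]_n -> \bar R}.
Hypothesis f_closed : closed_fun f.

Lemma closed_fun_le_limit (a : R) xs :
  (forall (e : R) Q, 0 < e -> nbhs xs Q -> exists2 x, Q x & (f x <= (a + e)%:E)%E) ->
  (f xs <= a%:E)%E.
Proof.
move=> H; apply: (f_closed (xs, a)) => O [[P Q] /= [nP nQ] PQO].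
have [e /= e0 eQ] := (nbhs_ballP _ _).1 nQ.
have e20 : 0 < e / 2 by rewrite divr_gt0.
have [x Px fx] := H _ _ e20 nP.
exists (x, a + e / 2); split=> //; apply: PQO; split=> //=; apply: eQ.
rewrite /ball /= opprD addrA subrr sub0r normrN gtr0_norm //; lra.
Qed.

(** The complement of the epigraph is open and contains [(xs, C)] for a real [C] below [f xs]. The
    value [+oo] is allowed: an accumulation point is not known beforehand to lie in the domain. *)
Lemma closed_fun_locally_gt xs : f xs != -oo%E ->
  exists C : R, \forall x \near xs, (C%:E < f x)%E.
Proof.
move=> fxs; have [C fC] : exists C : R, (C%:E < f xs)%E.
  case: (f xs) fxs => [r| |] // _; last by exists 0; rewrite ltry.
  by exists (r - 1); rewrite lte_fin ltrBlDr ltrDl.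
exists C; have : nbhs (xs, C) (~` epigraph f).
  apply: open_nbhs_nbhs; split; [exact: closed_openC|].
  by rewrite /= /epigraph /=; apply/negP; rewrite -ltNge.
move=> [[P Q] /= [nP nQ] PQ]; apply: filterS nP => x Px.
by have := PQ (x, C) (conj Px (nbhs_singleton nQ)); rewrite /epigraph /= => /negP; rewrite -ltNge.
Qed.

End ClosedFun.

(** Replaces the extraction of a subsequence; the shift is there because step [k] produces iterate
    [k.+1]. *)
Lemma cluster_seqS {T : topologicalType} {u : nat -> T} {x} :
  cluster (u @ \oo) x -> forall (P : nat -> Prop) Q,
  (\forall k \near \oo, P k) -> nbhs x Q -> exists k, P k /\ Q (u k.+1).
Proof.
move=> ux P Q [N _ NP] nQ.
have [|_ [[k kN <-] Qk]] := ux [set u k | k in [set k | (N < k)%N]] Q _ nQ.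
  by exists N.+1 => // k /= Nk; exists k.
by case: k kN Qk => // k Nk Qk; exists k; split=> //; exact: NP.
Qed.

Lemma mulmx_near {R : realType} {m n : nat} (A : 'M[R]_(m, n)) (x : 'cV[R]_n) (e : R) :
  0 < e -> \forall y \near x, forall i, `|(A *m y - A *m x) i 0| <= e.
Proof.
move=> e0; pose C := 1 + \sum_(p : 'I_m * 'I_n) `|A p.1 p.2|.
have C0 : 0 < C by rewrite ltr_wpDr // sumr_ge0.
apply/nbhs_ballP; exists (e / C) => /=; first by rewrite divr_gt0.
move=> y [_ xy] i; rewrite -mulmxBr mxE (le_trans (ler_norm_sum _ _ _)) //.
apply: (@le_trans _ _ (\sum_j `|A i j| * (e / C))).
  apply: ler_sum => j _; rewrite normrM ler_wpM2l //.
  by have := xy j 0; rewrite /ball /= distrC !mxE => /ltW.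
rewrite -mulr_suml mulrCA ger_pMr // ler_pdivrMr // mul1r.
rewrite /C -(pair_bigA _ (fun a b => `|A a b|)) /= (bigD1 i) //= addrCA lerDl.
by rewrite addr_ge0 // sumr_ge0 // => ? _; rewrite sumr_ge0.
Qed.

Lemma compact_dot_bounded {R : realType} {m : nat} (G : set 'cV[R]_m) :
  compact G -> exists2 L : R, 0 <= L & forall v, G v -> dot v v <= L.
Proof.
move=> /compact_bounded [M [_ GM]].
pose N := `|M| + 1.
have NM : M < N by rewrite (le_lt_trans (ler_norm _)) // ltrDl.
exists (\sum_(i < m) N ^+ 2); first by rewrite sumr_ge0 // => i _; rewrite sqr_ge0.
move=> v Gv; rewrite dotE; apply: ler_sum => i _; rewrite -expr2 -real_normK ?num_real //.
have N0 : 0 <= N by rewrite addr_ge0.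
rewrite ler_sqr ?nnegrE //; apply: le_trans (GM _ NM _ Gv).
rewrite [leRHS]/Num.Def.normr /= mx_normrE.
by apply/bigmax_geP; right => /=; exists (i, 0).
Qed.

(** * Penalty parameter and infeasibility *)

Section PenaltyUpdate.
Context {R : realType} {tau gamma : R}.
Hypotheses (tau_gt0 : 0 < tau) (tau_lt1 : tau < 1) (gamma_gt1 : 1 < gamma).
Context {u rho : nat -> R}.
Hypothesis u_ge0 : forall k, 0 <= u k.
Hypothesis rho0_gt0 : 0 < rho 0.
Hypothesis update : forall k,
  rho k.+1 = if u k.+1 <= tau * u k then rho k else gamma * rho k.

Lemma penalty_gt0 k : 0 < rho k.
Proof.
elim: k => // k IH; rewrite update; case: ifP => // _.
by rewrite mulr_gt0 // (lt_trans ltr01).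
Qed.

Lemma penalty_nondecreasing k l : (k <= l)%N -> rho k <= rho l.
Proof.
elim: l => [|l IH]; first by rewrite leqn0 => /eqP ->.
rewrite leq_eqVlt => /orP[/eqP -> //|/IH kl]; apply: (le_trans kl).
rewrite update; case: ifP => // _.
by rewrite ler_peMl ?ltW // penalty_gt0.
Qed.

Lemma expr_small (a e : R) : 0 < a -> a < 1 -> 0 < e ->
  \forall j \near \oo, a ^+ j <= e.
Proof.
move=> a0 a1 e0; have : `|a| < 1 by rewrite gtr0_norm.
move/cvg_expr/cvgr0_norm_le => /(_ _ e0); apply: filterS => j.
by rewrite normrX gtr0_norm.
Qed.

(** Either the decrease test succeeds from some index on, or it fails infinitely often and each
    failure multiplies [rho] by [gamma]. *)
Lemma penalty_dichotomy :
  (forall e, 0 < e -> \forall k \near \oo, u k <= e) \/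
  (forall M, \forall k \near \oo, M <= rho k).
Proof.
have [[K HK]|noK] := pselect (exists K, forall k, (K <= k)%N -> u k.+1 <= tau * u k).
  left=> e e0.
  have uK j : u (K + j)%N <= tau ^+ j * u K.
    elim: j => [|j IH]; first by rewrite addn0 mul1r.
    rewrite addnS (le_trans (HK _ (leq_addr _ _))) // exprS -mulrA.
    by rewrite ler_pM2l.
  have u1 : 0 < 1 + u K by rewrite ltr_wpDr.
  have [N _ HN] := expr_small tau (e / (1 + u K)) tau_gt0 tau_lt1 (divr_gt0 e0 u1).
  exists (K + N)%N => // k /= KNk.
  have Kk : (K <= k)%N by rewrite (leq_trans _ KNk) ?leq_addr.
  rewrite -(subnKC Kk) (le_trans (uK _)) //.
  apply: (@le_trans _ _ (e / (1 + u K) * (1 + u K))).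
    by rewrite ler_pM ?exprn_ge0 ?(ltW tau_gt0) ?lerDr ?HN //= leq_subRL.
  by rewrite divfK // gt_eqF.
right=> M.
have jump K : exists k, rho k.+1 = gamma * rho k /\ (K <= k)%N.
  apply: contrapT => H; apply: noK; exists K => k Kk.
  apply: contrapT => /negP uk; apply: H; exists k; split=> //.
  by rewrite update (negbTE uk).
have grow N : exists k, gamma ^+ N * rho 0 <= rho k.
  elim: N => [|N [k IH]]; first by exists 0%N; rewrite mul1r.
  have [l [ul kl]] := jump k; exists l.+1; rewrite ul exprS -mulrA ler_pM2l //.
    exact: le_trans IH (penalty_nondecreasing _ _ kl).
  exact: lt_trans gamma_gt1.
have g0 : 0 < gamma by apply: lt_trans gamma_gt1.
have M1 : 0 < 1 + `|M| by rewrite ltr_wpDr.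
have [N _ /(_ N (leqnn _)) HN] := expr_small gamma^-1 (rho 0 / (1 + `|M|))
  (etrans (invr_gt0 _) g0) (etrans (invf_lt1 g0) gamma_gt1) (divr_gt0 rho0_gt0 M1).
have [k Hk] := grow N; exists k => // l /= kl.
apply: le_trans (penalty_nondecreasing _ _ kl); apply: le_trans Hk.
move: HN; rewrite /= exprVn ler_pdivlMr // mulrC ler_pdivrMr ?exprn_gt0 //.
by rewrite mulrC; apply: le_trans; rewrite (le_trans (ler_norm _)) // lerDr.
Qed.

(* [q k] is the squared infeasibility of iterate [k.+1] and [l k] its pairing with the
   safeguarded multipliers, whose squared norm is at most [L]. *)
Context {L : R} {q l : nat -> R}.
Hypothesis L_ge0 : 0 <= L.
Hypothesis q_ge0 : forall k, 0 <= q k.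
Hypothesis q_le : forall k, q k <= u k.+1 ^+ 2.
Hypothesis l_ge : \forall k \near \oo, forall th, 0 < th ->
  - (th * L + th^-1 * q k / 4) <= l k.

(** If [u] tends to zero, a small fixed [th] in [l_ge] suffices. If [rho] tends to infinity,
    [th = 1 / rho k] leaves an error [L / rho k] and a multiple [rho k * q k / 4] absorbed by the
    penalty. *)
Lemma penalty_term_ge (e : R) : 0 < e ->
  \forall k \near \oo, - e <= l k + rho k / 2 * q k.
Proof.
move=> e0; have [u0|rhoy] := penalty_dichotomy.
  pose th := e / (2 * (1 + L)).
  have L1 : 0 < 1 + L by rewrite ltr_wpDr.
  have th0 : 0 < th by rewrite divr_gt0 // mulr_gt0.
  have thL : th * L <= e / 2.
    have -> : e / 2 = th * (1 + L) by rewrite /th; field; rewrite gt_eqF.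
    by rewrite ler_pM2l // lerDr.
  pose d := Num.min 1 (th * e).
  have d0 : 0 < d by rewrite lt_min ltr01 mulr_gt0.
  have [N _ HN] := u0 _ d0.
  near=> k.
  have lk : - (th * L + th^-1 * q k / 4) <= l k.
    by move: th th0 {thL d d0 HN}; near: k.
  have uk : u k.+1 <= d.
    apply: HN => /=; near: k; exists N => // j /= Nj; exact: leqW.
  have qk : th^-1 * q k <= e.
    rewrite ler_pdivrMl // (le_trans (q_le k)) // expr2.
    apply: (@le_trans _ _ (1 * d)); last by rewrite mul1r /d ge_min lexx orbT.
    by rewrite ler_pM // (le_trans uk) // ge_min lexx.
  have : 0 <= rho k / 2 * q k by rewrite mulr_ge0 // divr_ge0 // ltW // penalty_gt0.
  by lra.
near=> k.
have lk : forall th, 0 < th -> - (th * L + th^-1 * q k / 4) <= l k by near: k.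
have r0 := penalty_gt0 k.
have := lk (rho k)^-1; rewrite invr_gt0 invrK => /(_ r0).
have rL : (rho k)^-1 * L <= e.
  rewrite ler_pdivrMl // -ler_pdivrMr //; near: k; exact: rhoy.
have : 0 <= rho k * q k by rewrite mulr_ge0 // ltW.
by lra.
Unshelve. all: by end_near. Qed.

(** When [rho] tends to infinity, [th = 1 / rho k] yields [rho k * q k / 4 <= H + L / rho k]. *)
Lemma infeasibility_le (H e : R) : 0 < e ->
  \forall k \near \oo, l k + rho k / 2 * q k <= H -> q k <= e.
Proof.
move=> e0; have [u0|rhoy] := penalty_dichotomy.
  have d0 : 0 < Num.min 1 e by rewrite lt_min ltr01.
  have [N _ HN] := u0 _ d0; exists N => // k /= Nk _.
  have uk := HN k.+1 (leqW Nk).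
  rewrite (le_trans (q_le k)) // expr2.
  apply: (@le_trans _ _ (1 * Num.min 1 e)); last by rewrite mul1r ge_min lexx orbT.
  by rewrite ler_pM // (le_trans uk) // ge_min lexx.
near=> k => lH.
have lk : forall th, 0 < th -> - (th * L + th^-1 * q k / 4) <= l k by near: k.
have r0 := penalty_gt0 k.
have := lk (rho k)^-1; rewrite invr_gt0 invrK => /(_ r0).
have rL : (rho k)^-1 * L <= L.
  have r1 : 1 <= rho k by near: k; exact: rhoy.
  by rewrite ler_piMl // invf_le1.
have re : 4 * (`|H| + L) <= rho k * e.
  rewrite -ler_pdivrMr //; near: k; exact: rhoy.
have := ler_norm H => HH lk'.
have : rho k * q k <= rho k * e by lra.
by rewrite ler_pM2l.
Unshelve. all: by end_near. Qed.

End PenaltyUpdate.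

Lemma coord_le {R : realType} {m} {v : 'cV[R]_m} {e : R} i :
  0 <= e -> dot v v <= e ^+ 2 -> `|v i 0| <= e.
Proof.
move=> e0 ve; rewrite -(ler_pXn2r (n := 2)) ?nnegrE //.
by rewrite real_normK ?num_real // (le_trans (sqr_coord_le_dot v i)).
Qed.

(** * Proper convex functions and one step of the method *)

Section ProperConvex.
Context {R : realType} {n : nat} {f : 'cV[R]_n -> \bar R}.
Hypothesis f_neq_ninfty : forall x, f x != -oo%E.

Lemma effdom_fineK {x} : effdom f x -> (fine (f x))%:E = f x.
Proof. by move=> Dx; rewrite fineK // fin_numE f_neq_ninfty lt_eqF. Qed.

Hypothesis f_convex : econvex f.

Lemma econvex_fine x y (t : R) : effdom f x -> effdom f y -> 0 <= t -> t <= 1 ->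
  (f ((1 - t) *: x + t *: y) <= ((1 - t) * fine (f x) + t * fine (f y))%:E)%E.
Proof.
move=> Dx Dy; rewrite le_eqVlt => /orP[/eqP <- _|t0].
  by rewrite subr0 !scale1r !mul1r scale0r mul0r !addr0 effdom_fineK.
rewrite le_eqVlt => /orP[/eqP ->|t1].
  by rewrite subrr !scale1r !mul1r scale0r mul0r !add0r effdom_fineK.
by rewrite EFinD !EFinM !effdom_fineK //; exact: f_convex.
Qed.

Lemma effdom_convex x y t : effdom f x -> effdom f y -> 0 <= t -> t <= 1 ->
  effdom f ((1 - t) *: x + t *: y).
Proof.
move=> Dx Dy t0 t1; rewrite /effdom /=.
by rewrite (le_lt_trans (econvex_fine _ _ _ Dx Dy t0 t1)) // ltry.
Qed.

Lemma fine_convex x y t : effdom f x -> effdom f y -> 0 <= t -> t <= 1 ->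
  fine (f ((1 - t) *: x + t *: y)) <= (1 - t) * fine (f x) + t * fine (f y).
Proof.
move=> Dx Dy t0 t1; rewrite -lee_fin effdom_fineK; first exact: econvex_fine.
exact: effdom_convex.
Qed.

(** [z] satisfies the shifted constraints exactly, so its augmented Lagrangian value is [f z]. *)
Lemma al_step_le {m1 m2} {A1 : 'M[R]_(m1, n)} {A2 : 'M[R]_(m2, n)} {b1 b2}
    {rho eps : R} {sb1 sb2 lam1 lam2 s1 s2 x z} :
  eps_argmin (fun x => aug_lagrangian f A1 A2 b1 b2 rho sb1 sb2 x lam1 lam2)
    (effdom f) eps x ->
  effdom f z -> A1 *m z = b1 - sb1 -> A2 *m z = b2 - sb2 ->
  s1 = A1 *m x - b1 + sb1 -> s2 = A2 *m x - b2 + sb2 ->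
  fine (f x) + (dot lam1 s1 + dot lam2 s2 + rho / 2 * (dot s1 s1 + dot s2 s2))
    <= fine (f z) + eps.
Proof.
move=> [Dx xmin] Dz z1 z2 -> ->.
have s1z : A1 *m z - b1 + sb1 = 0 by rewrite z1 addrAC subrK subrr.
have s2z : A2 *m z - b2 + sb2 = 0 by rewrite z2 addrAC subrK subrr.
rewrite -lee_fin EFinD [leRHS]EFinD !effdom_fineK //.
have := le_trans xmin (leeD2r eps%:E (ereal_inf_lbound (imageP _ Dz))).
have dot0 m (v : 'cV[R]_m) : dot v 0 = 0 by rewrite /dot mulmx0 mxE.
rewrite /aug_lagrangian s1z s2z !enorm_sqr.
by rewrite -!/(dot _ _) !dot0 !addr0 mulr0 addr0 adde0.
Qed.

End ProperConvex.

(** * Accumulation points of the method *)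

Theorem theorem2 (R : realType) (n m1 m2 : nat) (f : 'cV[R]_n -> \bar R)
  (A1 : 'M[R]_(m1, n)) (A2 : 'M[R]_(m2, n))
  (b1 : 'cV[R]_m1) (b2 : 'cV[R]_m2)
  (f_neq_ninfty : forall x, f x != -oo%E)
  (f_convex : econvex f)
  (* (1) *)
  (shifted_solvable : forall s, feasible_shifts f A1 A2 b1 b2 s ->
     shifted_solutions f A1 A2 b1 b2 s.1 s.2 !=set0)
  (* (2) *)
  (s1s : 'cV[R]_m1) (s2s : 'cV[R]_m2)
  (s_hierarchical : hierarchical_shift f A1 A2 b1 b2 s1s s2s)
  (* (3) *)
  (f_closed : closed_fun f) (f_proper : proper_fun f)
  (slater : exists xb, [/\ rel_int (effdom f) xb,
     A1 *m xb - b1 + s1s = 0 & A2 *m xb - b2 + s2s = 0])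
  (* (4) *)
  (image_closed : closed [set col_mx A1 A2 *m x | x in effdom f])
  (* (5) *)
  (sg1 sg2 : nat -> R)
  (sg1_gt0 : forall k, 0 < sg1 k) (sg2_gt0 : forall k, 0 < sg2 k)
  (sg_infty : (fun k => sg1 k / sg2 k) @ \oo --> +oo)
  (sg_nondecreasing : forall k,
     sg1 k / sg2 k <= sg1 k.+1 / sg2 k.+1)
  (* parameters of the method *)
  (tau gamma : R) (tau_gt0 : 0 < tau) (tau_lt1 : tau < 1) (gamma_gt1 : 1 < gamma)
  (G1 : set 'cV[R]_m1) (G2 : set 'cV[R]_m2)
  (G1_nonempty : G1 !=set0) (G2_nonempty : G2 !=set0)
  (G1_compact : compact G1) (G2_compact : compact G2)
  (eps : nat -> R) (eps_gt0 : forall k, 0 < eps k) (eps_cvg0 : eps @ \oo --> (0 : R))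
  (* an infinite run of the method *)
  (st : nat -> al_state R n m1 m2)
  (st_init : al_init (st 0%N))
  (st_step : forall k, al_step f A1 A2 b1 b2 tau gamma G1 G2
     (sg1 k) (sg2 k) (eps k) (st k) (st k.+1))
  (xs : 'cV[R]_n)
  (xs_accumulation : cluster ((fun k => al_x (st k)) @ \oo) xs) :
  shifted_solutions f A1 A2 b1 b2 s1s s2s xs.
Proof.
have [xh [xh_ri xh1 xh2]] := slater.
have [kb [B [segB spanB]]] := rel_int_basis xh_ri.
have Dxh : effdom f xh.
  by have [e /ltW e0 /(_ 0)] := segB 0; rewrite normr0 scale0r addr0; apply.
have shiftE m (A : 'M[R]_(m, n)) (b s : 'cV_m) (x : 'cV_n) : A *m x - b + s = 0 -> s = b - A *m x.
  by move/eqP; rewrite addrC addr_eq0 => /eqP ->; rewrite opprB.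
have feas1 := shiftE _ _ _ _ _ xh1; have feas2 := shiftE _ _ _ _ _ xh2.
have shift_cvg := weighted_shift_cvg s_hierarchical Dxh feas1 feas2 segB spanB
  sg1 sg2 sg1_gt0 sg2_gt0 sg_infty.
have [L1 L10 G1L] := compact_dot_bounded _ G1_compact.
have [L2 L20 G2L] := compact_dot_bounded _ G2_compact.
pose u k := al_u (st k); pose rho k := al_rho (st k).
pose x k := al_x (st k.+1).
pose s1 k := al_s1 (st k.+1); pose s2 k := al_s2 (st k.+1).
pose q k := dot (s1 k) (s1 k) + dot (s2 k) (s2 k).
pose l k := dot (al_lamh1 (st k)) (s1 k) + dot (al_lamh2 (st k)) (s2 k).
have rho_update k : rho k.+1 = if u k.+1 <= tau * u k then rho k else gamma * rho k.
  by have [? [? [? [_ [_ [_ [_ [_ rhoE]]]]]]]] := st_step k; exact: rhoE.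
have uS k : u k.+1 = enorm (s1 k) + enorm (s2 k).
  by have [? [? [? [_ [_ [_ [_ [uE _]]]]]]]] := st_step k; exact: uE.
have [u00 rho00] := st_init.
have u_ge0 k : 0 <= u k.
  by case: k => [|k]; [exact: ltW|rewrite uS addr_ge0 ?enorm_ge0].
have q_ge0 k : 0 <= q k by rewrite addr_ge0 ?dot_ge0.
have q_le k : q k <= u k.+1 ^+ 2.
  rewrite uS /q -!enorm_sqr.
  have := enorm_ge0 (s1 k); have := enorm_ge0 (s2 k) => a0 b0.
  by have := mulr_ge0 b0 a0; lra.
have l_ge : \forall k \near \oo, forall th, 0 < th ->
    - (th * (L1 + L2) + th^-1 * q k / 4) <= l k.
  (* The initial multipliers are arbitrary; from index 1 on they are points of [G1] and [G2]. *)
  exists 1%N => // -[//|k] _ th th0.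
  have [? [? [? [_ [_ [[_ _ [lam1 _]] [[_ _ [lam2 _]] _]]]]]]] := st_step k.
  have := dot_young (al_lamh1 (st k.+1)) (s1 k.+1) _ th0.
  have := dot_young (al_lamh2 (st k.+1)) (s2 k.+1) _ th0.
  have := ler_wpM2l (ltW th0) (G1L _ lam1).
  have := ler_wpM2l (ltW th0) (G2L _ lam2).
  by rewrite /q /l; lra.
have L0 : 0 <= L1 + L2 by rewrite addr_ge0.
pose term_ge := penalty_term_ge tau_gt0 tau_lt1 gamma_gt1 u_ge0 rho00 rho_update
  L0 q_ge0 q_le l_ge.
pose infeas_le := infeasibility_le tau_gt0 tau_lt1 gamma_gt1 u_ge0 rho00 rho_update
  L0 q_le l_ge.
(* A feasible [w] can be moved to satisfy the constraints of step [k] at small cost. *)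
have step_le w e : shifted_feasible f A1 A2 b1 b2 s1s s2s w -> 0 < e ->
    \forall k \near \oo, fine (f (x k)) + (l k + rho k / 2 * q k) <= fine (f w) + e.
  move=> [w1 w2 Dw] e0; have e20 : 0 < e / 2 by rewrite divr_gt0.
  pose A := col_mx A1 A2.
  have Aw : A *m w = A *m xh.
    rewrite !mul_col_mx; congr col_mx; apply/eqP.
      by rewrite -(inj_eq (addIr (- b1))) -(inj_eq (addIr s1s)) w1 xh1.
    by rewrite -(inj_eq (addIr (- b2))) -(inj_eq (addIr s2s)) w2 xh2.
  have [dl dl0 usc] := value_function_usc
    (effdom_convex f_neq_ninfty f_convex) (fine_convex f_neq_ninfty f_convex)
    segB spanB _ A w (e / 2) e20 Dw Aw.
  have dl20 : 0 < dl ^+ 2 by rewrite exprn_gt0.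
  near=> k.
  have ek : eps k <= e / 2.
    rewrite (le_trans (ler_norm _)) //; near: k; by move: e20; apply: cvgr0_norm_le.
  have sk : forall xb sb1 sb2,
      weighted_shift_solutions f A1 A2 b1 b2 (sg1 k) (sg2 k) (xb, sb1, sb2) ->
      dot (sb1 - s1s) (sb1 - s1s) <= dl ^+ 2 /\ dot (sb2 - s2s) (sb2 - s2s) <= dl ^+ 2.
    by near: k; exact: shift_cvg.
  have [xb [sb1 [sb2 [sol [xmin [[s1E _ _] [[s2E _ _] _]]]]]]] := st_step k.
  have [d1 d2] := sk _ _ _ sol.
  have [[/= sb1E sb2E Dxb] _] := sol.
  (* [A xb] is near [A xh] because the shifts are near their limits; [z] has the image of [xb],
     hence zero residual at step [k]. *)
  have [|z [Dz Az gz]] := usc xb Dxb.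
    move=> i; rewrite !mul_col_mx opp_col_mx add_col_mx.
    have sbB m (C : 'M[R]_(m, n)) b : C *m xb - C *m xh = - (b - C *m xb - (b - C *m xh)).
      by rewrite !opprB [RHS]addrC addrA subrK.
    rewrite (sbB _ A1 b1) (sbB _ A2 b2) -sb1E -sb2E -feas1 -feas2 !mxE.
    by case: (fintype.split i) => j; rewrite [X in `|X|]mxE normrN; apply: coord_le (ltW dl0) _.
  move: Az; rewrite !mul_col_mx => /eq_col_mx [z1 z2].
  have solve m (a b s : 'cV[R]_m) : s = b - a -> a = b - s.
    by move=> ->; rewrite opprB addrC subrK.
  rewrite (solve _ _ _ _ sb1E) in z1; rewrite (solve _ _ _ _ sb2E) in z2.
  have := al_step_le f_neq_ninfty xmin Dz z1 z2 s1E s2E.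
  rewrite -/(x k) -/(s1 k) -/(s2 k) -/(rho k) -/(l k) -/(q k) => H.
  apply: le_trans H _; move: gz ek; lra.
have Dx k : effdom f (x k) by have [? [? [? [_ [[]]]]]] := st_step k.
have xh_feas : shifted_feasible f A1 A2 b1 b2 s1s s2s xh by [].
have xs_near e : 0 < e -> exists y sb1 sb2 r1 r2,
    [/\ r1 = A1 *m y - b1 + sb1, r2 = A2 *m y - b2 + sb2,
        forall i, `|(A1 *m y - A1 *m xs) i 0| <= e &
        forall i, `|(A2 *m y - A2 *m xs) i 0| <= e] /\
    [/\ dot r1 r1 <= e ^+ 2, dot r2 r2 <= e ^+ 2,
        dot (sb1 - s1s) (sb1 - s1s) <= e ^+ 2 &
        dot (sb2 - s2s) (sb2 - s2s) <= e ^+ 2].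
  move=> e0; have e20 : 0 < e ^+ 2 by rewrite exprn_gt0.
  have [C fC] := closed_fun_locally_gt f_closed xs (f_neq_ninfty xs).
  (* Near [xs] the values of [f] exceed [C], so comparison with [xh] at tolerance 1 bounds the added
     terms by [f xh + 1 - C]. *)
  have [k [[[kf kq] ksh] [[Cx kA1] kA2]]] := cluster_seqS xs_accumulation _ _
    (filterI (filterI (step_le _ _ xh_feas ltr01)
      (infeas_le (fine (f xh) + 1 - C) _ e20)) (shift_cvg _ e20))
    (filterI (filterI fC (mulmx_near A1 xs _ e0)) (mulmx_near A2 xs _ e0)).
  have [xb [sb1 [sb2 [sol [_ [[s1E _ _] [[s2E _ _] _]]]]]]] := st_step k.
  have [d1 d2] := ksh _ _ _ sol.
  have qe : q k <= e ^+ 2.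
    apply: kq; move: Cx; rewrite -/(x k) -(effdom_fineK f_neq_ninfty (Dx k)) lte_fin.
    by move: kf; lra.
  exists (x k), sb1, sb2, (s1 k), (s2 k); split; split=> //.
    by apply: le_trans qe; rewrite lerDl dot_ge0.
  by apply: le_trans qe; rewrite lerDr dot_ge0.
have block0 m (A : 'M[R]_(m, n)) (b ss : 'cV[R]_m) :
    (forall e, 0 < e -> exists y sb r,
      [/\ r = A *m y - b + sb, forall i, `|(A *m y - A *m xs) i 0| <= e,
          dot r r <= e ^+ 2 & dot (sb - ss) (sb - ss) <= e ^+ 2]) ->
    A *m xs - b + ss = 0.
  move=> H; apply/colP => i; rewrite [RHS]mxE; apply/eqP; rewrite -normr_le0.
  apply/ler_addgt0Pr => e e0; rewrite add0r.
  (* One third each for the residual, the displacement of the iterate and the shift error. *)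
  have e30 : 0 < e / 3 by rewrite divr_gt0.
  have [y [sb [r [rE yi /(coord_le i (ltW e30)) ri /(coord_le i (ltW e30)) si]]]] := H _ e30.
  have -> : A *m xs - b + ss = r - (A *m y - A *m xs) - (sb - ss).
    by rewrite rE; apply/colP => j; rewrite !mxE; ring.
  have := yi i; move: ri si.
  move: (A *m y - A *m xs) (sb - ss) => a c; rewrite !mxE => rd sc ya.
  apply: le_trans (ler_normB _ _) _; have := ler_normB (r i 0) (a i 0); lra.
have xs1 : A1 *m xs - b1 + s1s = 0.
  apply: block0 => e /xs_near[y [sb1 [? [r1 [? [[? _ ? _] [? _ ? _]]]]]]].
  by exists y, sb1, r1.
have xs2 : A2 *m xs - b2 + s2s = 0.
  apply: block0 => e /xs_near[y [? [sb2 [? [r2 [[_ ? _ ?] [_ ? _ ?]]]]]]].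
  by exists y, sb2, r2.
have xs_min w : shifted_feasible f A1 A2 b1 b2 s1s s2s w -> (f xs <= f w)%E.
  move=> wf; have [_ _ Dw] := wf; rewrite -(effdom_fineK f_neq_ninfty Dw).
  apply: (closed_fun_le_limit f_closed) => e Q e0 nQ.
  have e20 : 0 < e / 2 by rewrite divr_gt0.
  (* Half of [e] pays for the comparison with [w], half for the lower bound on the added terms. *)
  have [k [[kf kt] Qk]] := cluster_seqS xs_accumulation _ _
    (filterI (step_le _ _ wf e20) (term_ge _ e20)) nQ.
  exists (x k) => //; rewrite -(effdom_fineK f_neq_ninfty (Dx k)) lee_fin.
  by move: kf kt; lra.
(* Comparison with [xh] also places [xs] in the domain. *)
split=> //; split=> //; exact: le_lt_trans (xs_min _ xh_feas) Dxh.
Unshelve. all: by end_near.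
Qed.
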